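(* Let $\mathbf{k}$ be a commutative unitary ring, $\lambda\in\mathbf{k}$, and let $I$ be a Rota-Baxter ideal of the Rota-Baxter algebra $A_\lambda=\bigoplus_{m\ge0}\mathbf{k}\,\mathfrak{a}_m$ of weight $\lambda$, with ascent set $A(I)=\{(s_j,\Omega_{s_j})\mid j\in[N_I]\}$. Use the convention that for $j=0$ one puts $s_0=0$ and $\Omega_{s_0}=0$, and $s_{N_I+1}=\infty$ if $N_I$ is finite. Then $A_\lambda/I$ has the same underlying set as $A_\lambda/\mathrm{in}(I)$, namely that of $$\bigoplus_{j=0}^{N_I}\ \bigoplus_{i=s_j}^{s_{j+1}-1}(\mathbf{k}/\Omega_{s_j})\,\mathfrak{a}_i .$$ More precisely, for each $j\in\{0\}\cup[N_I]$ fix a complete set $T_j\subseteq\mathbf{k}$ of representatives of $\mathbf{k}$ modulo $\Omega_{s_j}$ with $0\in T_j$ (so $T_0=\mathbf{k}$). Then the subset $$\mathcal{T}:=\bigoplus_{j=0}^{N_I}\ \bigoplus_{i=s_j}^{s_{j+1}-1}T_j\,\mathfrak{a}_i\ \subseteq\ A_\lambda$$ is a complete set of representatives of $A_\lambda/I$.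
   Context: The algebra $A_\lambda$: as a $\mathbf{k}$-module it is free on the basis $\{\mathfrak{a}_m\mid m\ge 0\}$; the product is the $\mathbf{k}$-bilinear product determined by $$\mathfrak{a}_m\mathfrak{a}_n=\sum_{i=0}^{\min(m,n)}\binom{m+n-i}{m}\binom{m}{i}\lambda^i\,\mathfrak{a}_{m+n-i},\qquad m,n\ge 0,$$ with identity $\mathfrak{a}_0$; it carries the $\mathbf{k}$-linear operator $P$ with $P(\mathfrak{a}_m)=\mathfrak{a}_{m+1}$ for $m\ge 0$, and $(A_\lambda,P)$ is a (commutative) Rota-Baxter algebra of weight $\lambda$. A Rota-Baxter ideal of $A_\lambda$ is an ideal $I$ of the algebra $A_\lambda$ with $P(I)\subseteq I$; the Rota-Baxter ideal generated by a subset is the smallest Rota-Baxter ideal containing it. For nonzero $f=\sum_{i=0}^n c_i\mathfrak{a}_i$ with $c_n\ne 0$, the initial term of $f$ is $\mathrm{in}(f)=c_n\mathfrak{a}_n$. The initial Rota-Baxter ideal $\mathrm{in}(I)$ of a Rota-Baxter ideal $I$ is the Rota-Baxter ideal of $A_\lambda$ generated by $\{\mathrm{in}(f)\mid f\in I,\ f\neq 0\}$. Ascent set: for a Rota-Baxter ideal $I$ and $j\ge 0$, let $\Omega_j=\Omega_j(I)=\{0\}\cup\{b\in\mathbf{k}\mid \exists f\in I,\ \mathrm{in}(f)=b\,\mathfrak{a}_j\}$; these are ideals of $\mathbf{k}$ with $\Omega_j\subseteq\Omega_{j+1}$. Put $\Omega_{-1}=\{0\}$ and let $s_1<s_2<\cdots$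 be the integers $t\ge 0$ with $\Omega_{t-1}\subsetneq\Omega_t$, indexed by $[N_I]$ where $N_I\in\{0,1,2,\dots\}\cup\{\infty\}$ is their number. Here $[n]=\{1,\dots,n\}$ and $[\infty]$ is the set of positive integers. The ascent set is $A(I)=\{(s_j,\Omega_{s_j})\mid j\in[N_I]\}$. The symbol $\bigoplus$ in the definition of $\mathcal{T}$ denotes a subset, not a submodule: $\mathcal{T}$ is the set of all finite sums $\sum_i t_i\mathfrak{a}_i\in A_\lambda$ such that $t_i\in T_j$ whenever $s_j\le i<s_{j+1}$, $j\in\{0\}\cup[N_I]$. A complete set of representatives of a quotient is a set containing exactly one element of each coset. ''Same underlying set'' is meant in the sense that both quotients have such a set $\mathcal{T}$ as a complete set of representatives (it is a statement about sets, not about $\mathbf{k}$-module structures). *)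

(* Defs.v *)
From HB Require Import structures.
From mathcomp Require Import all_boot all_order all_algebra finmap.
From mathcomp Require Import boolp classical_sets.
From mathcomp.multinomials Require Import monalg.

Set Implicit Arguments.
Unset Strict Implicit.
Unset Printing Implicit Defensive.

Import GRing.Theory.
Local Open Scope classical_set_scope.
Local Open Scope ring_scope.

(* The underlying module of A_lambda is the free k-module on nat; the alias
   records lambda, so that it can carry the lambda-dependent product below.
   k is only a comPzRingType, so the zero ring is allowed. *)
Definition rba (k : comPzRingType) (lam : k) : Type := {malg k[nat]}.

Definition rba_basis {k : comPzRingType} {lam : k} (m : nat) : rba lam := << 1 *g m >>.
Notation "''a_' m" := (rba_basis m) (at level 8, m at level 2, format "''a_' m").

Section Module.
Context {k : comPzRingType} {lam : k}.
Notation A := (rba lam).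
Implicit Types (f g h : A) (F : nat -> A) (c : k).

HB.instance Definition _ := GRing.Zmodule.copy A {malg k[nat]}.

Lemma rbaP f g : (forall n, f@_n = g@_n) <-> f = g.
Proof. exact: malgP. Qed.

Lemma rba_coef0 n : (0 : A)@_n = 0.
Proof. exact: mcoeff0. Qed.

Lemma rba_coefD f g n : (f + g)@_n = f@_n + g@_n.
Proof. exact: mcoeffD. Qed.

Lemma rba_coefN f n : (- f)@_n = - f@_n.
Proof. exact: mcoeffN. Qed.

Lemma rba_coef_sum I (r : seq I) (Q : pred I) (F : I -> A) n :
  (\sum_(i <- r | Q i) F i)@_n = \sum_(i <- r | Q i) (F i)@_n.
Proof.
by apply: (big_morph (fun f : A => f@_n)) => [f g|]; rewrite ?rba_coefD ?rba_coef0.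
Qed.

Definition rba_scale c f : A := [malg n in msupp f => c * f@_n].

Lemma rba_scaleE c f n : (rba_scale c f)@_n = c * f@_n.
Proof. by rewrite mcoeffE; case: msuppP; rewrite ?mulr0. Qed.

Fact rba_scaleA c d f : rba_scale c (rba_scale d f) = rba_scale (c * d) f.
Proof. by apply/rbaP => n; rewrite !rba_scaleE mulrA. Qed.

Fact rba_scale1 : left_id 1 rba_scale.
Proof. by move=> f; apply/rbaP => n; rewrite rba_scaleE mul1r. Qed.

Fact rba_scaleDr : right_distributive rba_scale +%R.
Proof.
by move=> c f g; apply/rbaP => n; rewrite !(rba_scaleE, rba_coefD) mulrDr.
Qed.

Fact rba_scaleDl f : {morph rba_scale^~ f : c d / c + d}.
Proof. by move=> c d; apply/rbaP => n; rewrite !(rba_scaleE, rba_coefD) mulrDl. Qed.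

HB.instance Definition _ := GRing.Zmodule_isLmodule.Build k A
  rba_scaleA rba_scale1 rba_scaleDr rba_scaleDl.

Lemma rba_coefZ c f n : (c *: f)@_n = c * f@_n.
Proof. exact: rba_scaleE. Qed.


Lemma rba_coef_basis m n : ('a_m : A)@_n = (m == n)%:R.
Proof. exact: mcoeffU. Qed.

Lemma rba_sumEw f (D : {fset nat}) : {subset msupp f <= D} ->
  f = \sum_(m <- D) f@_m *: 'a_m.
Proof.
move=> sD; apply/rbaP => n; rewrite rba_coef_sum.
under eq_bigr do rewrite rba_coefZ rba_coef_basis.
case: (boolP (n \in D)) => nD.
  rewrite (big_fsetD1 n) //= eqxx mulr1 big1_fset ?addr0 // => i.
  by rewrite !inE => /andP[/negPf -> _] _; rewrite mulr0.
rewrite mcoeff_outdom; last by apply: contra nD; apply: sD.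
rewrite big1_fset // => i iD _; case: eqP => [e|]; last by rewrite mulr0.
by rewrite -e iD in nD.
Qed.

Lemma rba_sumE f : f = \sum_(m <- msupp f) f@_m *: 'a_m.
Proof. exact: rba_sumEw. Qed.

Lemma rba_ind (Q : A -> Prop) :
    Q 0 -> (forall f g, Q f -> Q g -> Q (f + g)) ->
    (forall c f, Q f -> Q (c *: f)) -> (forall m, Q 'a_m) ->
  forall f, Q f.
Proof.
move=> Q0 QD QZ Qb f; rewrite [f]rba_sumE.
by elim/big_rec: _ => // m g _ Qg; apply: QD => //; apply: QZ.
Qed.

End Module.

HB.lock Definition rba_lift (k : comPzRingType) (lam : k)
    (F : nat -> rba lam) (f : rba lam) : rba lam :=
  \sum_(m <- msupp f) f@_m *: F m.
Canonical rba_lift_unlockable := Unlockable rba_lift.unlock.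

Section LiftProduct.
Context {k : comPzRingType} {lam : k}.
Notation A := (rba lam).
Implicit Types (f g h : A) (F : nat -> A) (c : k).

Lemma rba_liftEw F f (D : {fset nat}) : {subset msupp f <= D} ->
  rba_lift F f = \sum_(m <- D) f@_m *: F m.
Proof.
move=> /fsubsetP sD; rewrite rba_lift.unlock; apply: (big_fset_incl _ sD).
by move=> m _ /mcoeff_outdom ->; rewrite scale0r.
Qed.

Fact rba_lift_linear F : linear (rba_lift F).
Proof.
move=> c f g; pose D := (msupp (c *: f + g : A) `|` (msupp f `|` msupp g))%fset.
have [s1 s2 s3] : [/\ {subset msupp (c *: f + g : A) <= D},
    {subset msupp f <= D} & {subset msupp g <= D}].
  by split=> m mf; rewrite !in_fsetU mf ?orbT.
rewrite (rba_liftEw F s1) (rba_liftEw F s2) (rba_liftEw F s3).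
rewrite scaler_sumr -big_split /=; apply: eq_bigr => m _.
by rewrite rba_coefD rba_coefZ scalerDl scalerA.
Qed.

HB.instance Definition _ F :=
  GRing.isLinear.Build k A A *:%R (rba_lift F) (rba_lift_linear F).

Lemma rba_lift_basis F m : rba_lift F 'a_m = F m.
Proof.
rewrite (@rba_liftEw _ _ [fset m]%fset); last by move=> i; apply/fsubsetP/msuppU_le.
by rewrite big_seq_fset1 rba_coef_basis eqxx scale1r.
Qed.

Definition rba_P : A -> A := rba_lift (fun m => 'a_m.+1).
HB.instance Definition _ := GRing.Linear.on rba_P.

Lemma rba_P_basis m : rba_P 'a_m = 'a_m.+1.
Proof. exact: rba_lift_basis. Qed.

Lemma rba_P0 : rba_P 0 = 0. Proof. exact: linear0. Qed.
Lemma rba_PD f g : rba_P (f + g) = rba_P f + rba_P g. Proof. exact: linearD. Qed.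
Lemma rba_PZ c f : rba_P (c *: f) = c *: rba_P f. Proof. exact: linearZ. Qed.

Definition rba_mulb (m n : nat) : A :=
  \sum_(i < (minn m n).+1)
    (('C(m + n - i, m) * 'C(m, i))%:R * lam ^+ i) *: 'a_(m + n - i).

End LiftProduct.

HB.lock Definition rba_mul (k : comPzRingType) (lam : k) (f g : rba lam) : rba lam :=
  \sum_(m <- msupp f) \sum_(n <- msupp g) (f@_m * g@_n) *: rba_mulb m n.
Canonical rba_mul_unlockable := Unlockable rba_mul.unlock.

Section Algebra.
Context {k : comPzRingType} {lam : k}.
Notation A := (rba lam).
Implicit Types (f g h : A) (F : nat -> A) (c : k).

Lemma rba_mulE f g :
  rba_mul f g = rba_lift (fun m => rba_lift (rba_mulb m) g) f.
Proof.
rewrite rba_mul.unlock !rba_lift.unlock; apply: eq_bigr => m _.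
by rewrite scaler_sumr; apply: eq_bigr => n _; rewrite scalerA.
Qed.

Lemma rba_liftD F F' f :
  rba_lift (fun m => F m + F' m) f = rba_lift F f + rba_lift F' f.
Proof.
by rewrite rba_lift.unlock -big_split; apply: eq_bigr => m _; rewrite scalerDr.
Qed.

Lemma rba_liftZ c F f : rba_lift (fun m => c *: F m) f = c *: rba_lift F f.
Proof.
rewrite rba_lift.unlock scaler_sumr; apply: eq_bigr => m _.
by rewrite !scalerA mulrC.
Qed.

Lemma rba_mulDl : left_distributive (@rba_mul k lam) +%R.
Proof. by move=> f g h; rewrite !rba_mulE linearD. Qed.

Lemma rba_mulDr : right_distributive (@rba_mul k lam) +%R.
Proof.
move=> f g h; rewrite !rba_mulE -rba_liftD; congr (rba_lift _ f).
by apply/funext => m; rewrite linearD.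
Qed.

Lemma rba_mulZl c f g : rba_mul (c *: f) g = c *: rba_mul f g.
Proof. by rewrite !rba_mulE linearZ. Qed.

Lemma rba_mulZr c f g : rba_mul f (c *: g) = c *: rba_mul f g.
Proof.
rewrite !rba_mulE -rba_liftZ; congr (rba_lift _ f).
by apply/funext => m; rewrite linearZ.
Qed.

Lemma rba_mul0l g : rba_mul 0 g = 0.
Proof. by rewrite -[X in rba_mul X _](scale0r 0) rba_mulZl scale0r. Qed.

Lemma rba_mul0r f : rba_mul f 0 = 0.
Proof. by rewrite -[X in rba_mul _ X](scale0r 0) rba_mulZr scale0r. Qed.

Lemma rba_mul_basis m n : rba_mul ('a_m : A) 'a_n = rba_mulb m n.
Proof. by rewrite rba_mulE !rba_lift_basis. Qed.

Lemma rba_mulb_widen m n d : (minn m n < d)%N ->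
  (rba_mulb m n : A) = \sum_(i < d)
    (('C(m + n - i, m) * 'C(m, i))%:R * lam ^+ i) *: 'a_(m + n - i).
Proof.
move=> ltd; pose F i : A :=
  (('C(m + n - i, m) * 'C(m, i))%:R * lam ^+ i) *: 'a_(m + n - i).
rewrite /rba_mulb (big_ord_widen d F) // big_mkcond; apply: eq_bigr => i _.
case: ltnP => // lei; rewrite /F.
suff -> : ('C(m + n - i, m) * 'C(m, i) = 0)%N by rewrite mul0r scale0r.
case: (leqP i m) => [le_im|lt_mi]; last by rewrite ['C(m, i)]bin_small ?muln0.
rewrite bin_small ?mul0n //; move: lei; rewrite gtn_min ltnNge le_im /= => lt_ni.
by rewrite ltn_subLR ?(leq_trans le_im) ?leq_addr // addnC ltn_add2r.
Qed.

Lemma rba_mulbS m n : (rba_mulb m.+1 n.+1 : A) =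
  rba_P (rba_mulb m n.+1) + rba_P (rba_mulb m.+1 n) + lam *: rba_P (rba_mulb m n).
Proof.
have [d def_d] : {d | d = (m + n).+1} by exists (m + n).+1.
rewrite (@rba_mulb_widen m.+1 n.+1 d.+1); last first.
  by rewrite def_d minnSS !ltnS (leq_trans (geq_minl _ _)) ?leq_addr.
rewrite (@rba_mulb_widen m n.+1 d.+1); last first.
  by rewrite def_d ltnS (leq_trans (geq_minl _ _)) // -addnS leq_addr.
rewrite (@rba_mulb_widen m.+1 n d.+1); last first.
  by rewrite def_d ltnS (leq_trans (geq_minl _ _)) // -addSn leq_addr.
rewrite (@rba_mulb_widen m n d); last first.
  by rewrite def_d ltnS (leq_trans (geq_minl _ _)) ?leq_addr.
rewrite !(linear_sum (rba_P : {linear A -> A})) /= scaler_sumr.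
under [X in _ = X + _ + _]eq_bigr do rewrite linearZ /= rba_P_basis.
under [X in _ = _ + X + _]eq_bigr do rewrite linearZ /= rba_P_basis.
under [X in _ = _ + X]eq_bigr do rewrite [rba_P _]linearZ /= rba_P_basis scalerA.
rewrite -big_split /= !big_ord_recl /= !bin0 !subn0 !muln1 !expr0 !mulr1.
rewrite -[X in _ = X]addrA; congr (_ + _).
  by rewrite !addnS !addSn -scalerDl -natrD binS addnC.
rewrite -big_split /=; apply: eq_bigr => i _; rewrite /bump /= !add1n.
have lei : (i <= m + n)%N by rewrite -ltnS -def_d.
have -> : (m.+1 + n.+1 - i.+1 = (m + n - i).+1)%N.
  by rewrite addSn addnS subSS subSn.
have -> : (m + n.+1 - i.+1 = m + n - i)%N by rewrite addnS subSS.
have -> : (m.+1 + n - i.+1 = m + n - i)%N by rewrite addSn subSS.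
rewrite -!scalerDl; congr (_ *: _).
rewrite mulrCA -exprS -!mulrDl -!natrD; congr (_%:R * _).
rewrite [in LHS]binS mulnDl [X in (_ + _ * X)%N]binS mulnDr.
by rewrite addnA [X in (X + _)%N]addnC.
Qed.

Lemma rba_mulb0l n : rba_mulb 0 n = 'a_n :> A.
Proof.
by rewrite /rba_mulb min0n big_ord1 !bin0 subn0 add0n mulr1 scale1r.
Qed.

Lemma rba_mulb0r m : rba_mulb m 0 = 'a_m :> A.
Proof.
by rewrite /rba_mulb minn0 big_ord1 addn0 subn0 binn bin0 mulr1 scale1r.
Qed.

Lemma rba_mulbC m n : rba_mulb m n = rba_mulb n m :> A.
Proof.
elim: m n => [|m IHm] n; first by rewrite rba_mulb0l rba_mulb0r.
elim: n => [|n IHn]; first by rewrite rba_mulb0l rba_mulb0r.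
by rewrite !rba_mulbS IHn !IHm [X in X + _]addrC.
Qed.

Fact rba_mulC : commutative (@rba_mul k lam).
Proof.
move=> f g; elim/(@rba_ind k lam): f => [|f f' IHf IHf'|c f IHf|m].
- by rewrite rba_mul0l rba_mul0r.
- by rewrite rba_mulDl rba_mulDr IHf IHf'.
- by rewrite rba_mulZl rba_mulZr IHf.
elim/(@rba_ind k lam): g => [|g g' IHg IHg'|c g IHg|n].
- by rewrite rba_mul0l rba_mul0r.
- by rewrite rba_mulDl rba_mulDr IHg IHg'.
- by rewrite rba_mulZl rba_mulZr IHg.
by rewrite !rba_mul_basis rba_mulbC.
Qed.

Fact rba_mul1 : left_id 'a_0 (@rba_mul k lam).
Proof.
elim/(@rba_ind k lam) => [|f f' IHf IHf'|c f IHf|m].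
- by rewrite rba_mul0r.
- by rewrite rba_mulDr IHf IHf'.
- by rewrite rba_mulZr IHf.
by rewrite rba_mul_basis rba_mulb0l.
Qed.

Lemma rba_mul_P f g : rba_mul (rba_P f) (rba_P g) =
  rba_P (rba_mul f (rba_P g)) + rba_P (rba_mul (rba_P f) g)
  + lam *: rba_P (rba_mul f g).
Proof.
elim/(@rba_ind k lam): f => [|f f' IHf IHf'|c f IHf|m].
- by rewrite !(rba_P0, rba_mul0l) scaler0 !addr0.
- rewrite !(rba_PD, rba_mulDl) /= IHf IHf' scalerDr.
  by rewrite [LHS]addrACA [X in X + _ = _]addrACA.
- by rewrite !(rba_PZ, rba_mulZl) IHf !scalerDr !scalerA mulrC.
elim/(@rba_ind k lam): g => [|g g' IHg IHg'|c g IHg|n].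
- by rewrite !(rba_P0, rba_mul0r) scaler0 !addr0.
- rewrite !(rba_PD, rba_mulDr) /= IHg IHg' scalerDr.
  by rewrite [LHS]addrACA [X in X + _ = _]addrACA.
- by rewrite !(rba_PZ, rba_mulZr) IHg !scalerDr !scalerA mulrC.
by rewrite !rba_P_basis !rba_mul_basis rba_mulbS.
Qed.

Lemma rba_mul_basisA l m n :
  rba_mul ('a_l : A) (rba_mul 'a_m 'a_n) = rba_mul (rba_mul 'a_l 'a_m) 'a_n.
Proof.
have [d] := ubnP (l + m + n)%N; elim: d => // d IHd in l m n *.
case: l => [|l]; first by rewrite !rba_mul1.
case: m => [|m]; first by rewrite rba_mul1 (rba_mulC 'a_l.+1 'a_0) rba_mul1.
case: n => [|n]; first
  by rewrite (rba_mulC 'a_m.+1 'a_0) (rba_mulC (rba_mul _ _) 'a_0) !rba_mul1.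
rewrite ltnS => led; rewrite -!rba_P_basis.
set x := 'a_l; set y := 'a_m; set z := 'a_n.
have [e1 e2 e3] : [/\ rba_mul x (rba_mul (rba_P y) (rba_P z))
     = rba_mul (rba_mul x (rba_P y)) (rba_P z),
   rba_mul (rba_P x) (rba_mul y (rba_P z))
     = rba_mul (rba_mul (rba_P x) y) (rba_P z) &
   rba_mul (rba_P x) (rba_mul (rba_P y) z)
     = rba_mul (rba_mul (rba_P x) (rba_P y)) z].
  by rewrite !rba_P_basis; split; apply: IHd; move: led; rewrite !addSn !addnS.
have [e4 e5 e6 e7] : [/\ rba_mul x (rba_mul y (rba_P z))
     = rba_mul (rba_mul x y) (rba_P z),
   rba_mul x (rba_mul (rba_P y) z) = rba_mul (rba_mul x (rba_P y)) z,
   rba_mul (rba_P x) (rba_mul y z) = rba_mul (rba_mul (rba_P x) y) z &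
   rba_mul x (rba_mul y z) = rba_mul (rba_mul x y) z].
  rewrite !rba_P_basis; split; apply: IHd; apply: leq_trans led;
    by rewrite !(addSn, addnS) !ltnS; do ?[exact: leqnn | apply: leqW].
have -> : rba_mul (rba_P x) (rba_mul (rba_P y) (rba_P z)) =
    rba_P (rba_mul x (rba_mul (rba_P y) (rba_P z)))
  + (rba_P (rba_mul (rba_P x) (rba_mul y (rba_P z)))
     + rba_P (rba_mul (rba_P x) (rba_mul (rba_P y) z))
     + lam *: rba_P (rba_mul (rba_P x) (rba_mul y z)))
  + (lam *: rba_P (rba_mul x (rba_mul y (rba_P z)))
     + lam *: rba_P (rba_mul x (rba_mul (rba_P y) z))
     + lam *: (lam *: rba_P (rba_mul x (rba_mul y z)))).
  rewrite [rba_mul (rba_P y) (rba_P z)]rba_mul_P -rba_PZ -!rba_PD rba_mul_P.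
  by rewrite !(rba_mulDr, rba_mulZr, rba_PD, rba_PZ) !scalerDr.
have -> : rba_mul (rba_mul (rba_P x) (rba_P y)) (rba_P z) =
    (rba_P (rba_mul (rba_mul x (rba_P y)) (rba_P z))
     + rba_P (rba_mul (rba_mul (rba_P x) y) (rba_P z))
     + lam *: rba_P (rba_mul (rba_mul x y) (rba_P z)))
  + rba_P (rba_mul (rba_mul (rba_P x) (rba_P y)) z)
  + (lam *: rba_P (rba_mul (rba_mul x (rba_P y)) z)
     + lam *: rba_P (rba_mul (rba_mul (rba_P x) y) z)
     + lam *: (lam *: rba_P (rba_mul (rba_mul x y) z))).
  rewrite [rba_mul (rba_P x) (rba_P y)]rba_mul_P -rba_PZ -!rba_PD rba_mul_P.
  by rewrite !(rba_mulDl, rba_mulZl, rba_PD, rba_PZ) !scalerDr.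
rewrite e1 e2 e3 e4 e5 e6 e7.
by rewrite [LHS](AC (1*3*3) ((1*2*5)*3*(6*4*7)))%AC.
Qed.

Fact rba_mulA : associative (@rba_mul k lam).
Proof.
move=> f g h; elim/(@rba_ind k lam): f => [|f f' IHf IHf'|c f IHf|l].
- by rewrite !rba_mul0l.
- by rewrite !rba_mulDl IHf IHf'.
- by rewrite !rba_mulZl IHf.
elim/(@rba_ind k lam): g => [|g g' IHg IHg'|c g IHg|m].
- by rewrite !(rba_mul0l, rba_mul0r).
- by rewrite !(rba_mulDl, rba_mulDr) IHg IHg'.
- by rewrite !(rba_mulZl, rba_mulZr) IHg.
elim/(@rba_ind k lam): h => [|h h' IHh IHh'|c h IHh|n].
- by rewrite !rba_mul0r.
- by rewrite !rba_mulDr IHh IHh'.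
- by rewrite !rba_mulZr IHh.
exact: rba_mul_basisA.
Qed.

HB.instance Definition _ := GRing.Zmodule_isComPzRing.Build A
  rba_mulA rba_mulC rba_mul1 rba_mulDl.

Lemma rba_scalerAl c f g : c *: (f * g) = c *: f * g.
Proof. by rewrite -[RHS]/(rba_mul _ _) rba_mulZl. Qed.

Lemma rba_scalerAr c f g : c *: (f * g) = f * (c *: g).
Proof. by rewrite -[RHS]/(rba_mul _ _) rba_mulZr. Qed.

Lemma rba_1E : 1 = 'a_0 :> A.
Proof. by []. Qed.

Lemma rba_basisM m n : 'a_m * 'a_n = \sum_(i < (minn m n).+1)
  (('C(m + n - i, m) * 'C(m, i))%:R * lam ^+ i) *: 'a_(m + n - i) :> A.
Proof. exact: rba_mul_basis. Qed.

Lemma rba_rota_baxter f g : rba_P f * rba_P g =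
  rba_P (f * rba_P g) + rba_P (rba_P f * g) + lam *: rba_P (f * g).
Proof. exact: rba_mul_P. Qed.

End Algebra.

Definition is_ideal (R : comPzRingType) (I : set R) : Prop :=
  [/\ I 0, forall x y, I x -> I y -> I (x + y) & forall a x, I x -> I (a * x)].

Section RotaBaxterIdeals.
Context {k : comPzRingType} {lam : k}.
Notation A := (rba lam).
Implicit Types (f g h : A) (I : set A).

Definition rb_ideal I : Prop := is_ideal I /\ rba_P @` I `<=` I.

Definition rba_deg f : nat := \max_(m <- msupp f) m.

(* Meaningful for f != 0 only. *)
Definition rba_in f : A := f@_(rba_deg f) *: 'a_(rba_deg f).

Lemma rba_inE f n :
  f@_n != 0 -> (forall i, (n < i)%N -> f@_i = 0) -> rba_in f = f@_n *: 'a_n.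
Proof.
move=> fn fgt; rewrite /rba_in; suff -> : rba_deg f = n by [].
have nf : n \in msupp f by rewrite -mcoeff_neq0.
apply/eqP; rewrite eqn_leq (leq_bigmax_seq _ nf) // andbT.
apply/bigmax_leqP_seq => i; rewrite -mcoeff_neq0 => fi _.
by rewrite leqNgt; apply: contra fi => /fgt ->.
Qed.

Definition initial_ideal I : set A :=
  smallest rb_ideal [set rba_in f | f in I `\ 0].

Lemma initial_ideal_rb_ideal I : rb_ideal (initial_ideal I).
Proof.
split; first split.
- by move=> J [[[]]].
- by move=> x y Jx Jy J HJ; have [[[_ JD _] _] _] := HJ; apply: JD; [apply: Jx|apply: Jy].
- by move=> a x Jx J HJ; have [[[_ _ JM] _] _] := HJ; apply: JM; apply: Jx.
move=> _ [x Jx <-] J HJ; have [[_ JP] _] := HJ.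
by apply: JP; exists x => //; apply: Jx.
Qed.

Definition Omega I (j : nat) : set k :=
  [set 0] `|` [set b | exists2 f, (I `\ 0) f & rba_in f = b *: 'a_j].

(* Omega_{t-1}, with the convention Omega_{-1} = 0 *)
Definition Omega_pred I (t : nat) : set k :=
  if t is t'.+1 then Omega I t' else [set 0].

Definition ascent I (t : nat) : Prop := Omega_pred I t `<` Omega I t.

End RotaBaxterIdeals.

(* N : option nat encodes N_I, with None for infinity: [le_index N j] is
   j <= N_I, so that it describes {0} U [N_I]. *)
Definition le_index (N : option nat) (j : nat) : bool :=
  if N is Some n then (j <= n)%N else true.

Definition pos_index (N : option nat) (j : nat) : bool :=
  (0 < j)%N && le_index N j.

(* s_1 < s_2 < ... , indexed by [N_I], are exactly the elements of D, and
   s_0 = 0 by convention; possibly s_0 = s_1. Beyond N_I, s is arbitrary. *)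
Record increasing_enum (D : set nat) (N : option nat) (s : nat -> nat) : Prop :=
  IncreasingEnum {
    enum0 : s 0%N = 0%N;
    enum_lt : forall i j,
      pos_index N i -> pos_index N j -> (i < j)%N -> (s i < s j)%N;
    enum_range : [set s j | j in [set j | pos_index N j]] = D }.

Definition ascent_enum (k : comPzRingType) (lam : k) (I : set (rba lam)) :=
  increasing_enum (ascent I).

Lemma increasing_enum_exists (D : set nat) : exists N s, increasing_enum D N s.
Proof.
pose p t := `[< D t >]; pose c t := count p (iota 0 t).
have cS t : c t.+1 = (c t + p t)%N by rewrite /c -addn1 iotaD count_cat /= addn0.
have cmono : {homo c : t u / (t <= u)%N}.
  by move=> t u /subnKC <-; rewrite /c iotaD count_cat leq_addr.
have clt t u : p t -> (t < u)%N -> (c t < c u)%N.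
  by move=> pt /cmono; apply: leq_trans; rewrite cS pt addn1.
have level t i : (i < c t)%N -> exists u, p u && (c u == i).
  elim: t => [|t IHt] //; rewrite cS; case: (ltnP i (c t)) => [/IHt //|le_ci].
  case: (boolP (p t)) => pt /=; last by rewrite addn0 ltnNge le_ci.
  rewrite addn1 ltnS => le_ic.
  by exists t; rewrite pt eqn_leq le_ci le_ic.
pose lev j := exists u, p u && (c u == j).
pose s j := if j is j'.+1 then
  if pselect (lev j') is left e then xchoose e else 0%N else 0%N.
have sP j : lev j -> p (s j.+1) /\ c (s j.+1) = j.
  by rewrite /s /=; case: pselect => // e _; case/andP: (xchooseP e) => ? /eqP.
have [N NP] : exists N, forall j, pos_index N j.+1 <-> lev j.
  have [all_lev|] := pselect (forall j, lev j); first by exists None; split.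
  move=> /existsNP nlev; have ex : exists j, ~~ `[< lev j >].
    by case: nlev => j ?; exists j; apply/asboolPn.
  exists (Some (ex_minn ex)) => j; case: ex_minnP => m /asboolPn nm min_m.
  split=> [lt_jm|[u /andP[pu /eqP cu]]].
    by apply/asboolP; apply: contraTT lt_jm => /min_m; rewrite /pos_index /= -leqNgt.
  rewrite /pos_index /= ltnNge; apply/negP => le_mj; apply: nm.
  by apply: (level u.+1); rewrite cS pu addn1 cu ltnS.
exists N, s; split=> //.
  move=> [|i] [|j] // /NP/sP[pi ci] /NP/sP[pj cj]; rewrite ltnS => lt_ij.
  rewrite ltnNge leq_eqVlt; apply/negP => /orP[/eqP e|/(clt _ _ pj)].
    by move: lt_ij; rewrite -ci -cj e ltnn.
  by rewrite ci cj ltnNge ltnW.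
apply/seteqP; split=> [_ [[|j] // /NP/sP[pj _] <-]|t Dt]; first exact/asboolP.
have pt : p t by apply/asboolP.
have lt : lev (c t) by exists t; rewrite pt eqxx.
have [ps cs] := sP _ lt; exists (c t).+1; first exact/NP.
case: (ltngtP (s (c t).+1) t) => // [/(clt _ _ ps)|/(clt _ _ pt)];
  by rewrite cs ltnn.
Qed.

(* T contains exactly one element of each coset x + W. *)
Definition complete_reprs (V : zmodType) (W T : set V) : Prop :=
  forall x, exists! t, T t /\ W (t - x).

Section Representatives.
Context {k : comPzRingType} {lam : k}.
Implicit Types (I : set (rba lam)) (N : option nat) (s : nat -> nat).
Implicit Types (T : nat -> set k).

(* Omega_{s_j}, with the convention Omega_{s_0} = 0 even if s_0 = s_1 = 0 *)
Definition Omega_at I s (j : nat) : set k :=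
  if j is 0%N then [set 0] else Omega I (s j).

Definition reprs_family I N s T : Prop :=
  forall j, le_index N j -> complete_reprs (Omega_at I s j) (T j) /\ T j 0.

(* s_j <= i < s_{j+1}, with the convention s_{N_I + 1} = oo *)
Definition in_block N s (j i : nat) : Prop :=
  (s j <= i)%N /\ (le_index N j.+1 -> (i < s j.+1)%N).

(* Elements of rba lam have finite support, so this is the set of all finite
   sums of terms t_i 'a_i with t_i in T_j whenever s_j <= i < s_{j+1}. *)
Definition reprs_sum N s T : set (rba lam) :=
  [set f | forall j i, le_index N j -> in_block N s j i -> T j f@_i].

End Representatives.

(* Main.v *)
(** The initial ideal of [I] consists of the [f] all of whose coefficients
    satisfy [f_i \in Omega_i]: these [f] form a Rota-Baxter ideal, because the
    product of ['a_m] and ['a_n] only involves ['a_p] with [p >= n] and [Omega]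
    is increasing.  Hence [I] and its initial ideal have the same leading
    coefficients [Omega_i] in each degree [i], and for any additive subgroup of
    the free module, reduction from the top degree downwards shows that choosing
    each coefficient among representatives modulo the leading coefficients of
    that degree gives exactly one element in every coset. *)
Require Import Defs.
From HB Require Import structures.
From mathcomp Require Import all_boot all_order all_algebra finmap.
From mathcomp Require Import boolp classical_sets.
From mathcomp.multinomials Require Import monalg.

Set Implicit Arguments.
Unset Strict Implicit.
Unset Printing Implicit Defensive.

Import GRing.Theory.
Local Open Scope classical_set_scope.
Local Open Scope ring_scope.

(** * Additive subgroups and representatives of their cosets *)

Definition is_subgroup (V : zmodType) (W : set V) : Prop :=
  W 0 /\ forall x y, W x -> W y -> W (x - y).

Lemma is_subgroupN (V : zmodType) (W : set V) x : is_subgroup W -> W x -> W (- x).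
Proof. by move=> [W0 WB] Wx; rewrite -sub0r; apply: WB. Qed.

Lemma is_subgroupD (V : zmodType) (W : set V) x y :
  is_subgroup W -> W x -> W y -> W (x + y).
Proof.
by move=> sW Wx Wy; rewrite -[y]opprK; apply: (sW.2) => //; apply: is_subgroupN.
Qed.

Lemma is_ideal_subgroup (R : comPzRingType) (J : set R) :
  is_ideal J -> is_subgroup J.
Proof.
by move=> [J0 JD JM]; split=> // x y Jx Jy; apply: JD; rewrite // -mulN1r; apply: JM.
Qed.

Lemma complete_reprs_exists (V : zmodType) (W : set V) :
  is_subgroup W -> exists T, complete_reprs W T /\ T 0.
Proof.
move=> sW; have [W0 WB] := sW.
(* The second clause makes [0] the representative of [W] itself. *)
pose C x := [set y : V | W (y - x) /\ (W x -> y = 0)].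
pose r x := xget 0 (C x).
have rP x : C x (r x).
  rewrite /r; case: xgetP => [_ -> //|Cx]; exfalso.
  have [Wx|nWx] := pselect (W x).
    by apply: (Cx 0); split=> //; rewrite sub0r; apply: is_subgroupN.
  by apply: (Cx x); split=> //; rewrite subrr.
(* [xget] sees only the set [C x], so this equality makes [r] constant on each coset. *)
have CE x y : W (x - y) -> C x = C y.
  move=> Wxy; have Wyx : W (y - x) by rewrite -opprB; apply: is_subgroupN.
  have WE : W x <-> W y.
    split=> Wz; first by rewrite -[y](subrK x); apply: is_subgroupD.
    by rewrite -[x](subrK y); apply: is_subgroupD.
  apply/seteqP; split=> z [Wz zE]; split; try by move/WE.
    by rewrite -[z](subrK x) -addrA; apply: is_subgroupD.
  by rewrite -[z](subrK y) -addrA; apply: is_subgroupD.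
exists (range r); split; last first.
  by exists 0 => //; have [_] := rP 0; apply.
move=> x; exists (r x); split; first by split; [exists x|case: (rP x)].
move=> _ [[y _ <-] Wyx]; rewrite /r (CE x y) //.
have [Wry _] := rP y.
rewrite -[x - y]opprB; apply: is_subgroupN => //.
rewrite -[y - x](subrKA (r y)); apply: is_subgroupD => //.
by rewrite -opprB; apply: is_subgroupN.
Qed.

(** * Leading coefficients by degree, and reduction from the top degree *)

Section LeadingCoefficients.
Context {k : comPzRingType} {lam : k}.
Notation A := (rba lam).
Implicit Types (f g : A) (W I : set A).

Lemma rba_coefB f g n : (f - g)@_n = f@_n - g@_n.
Proof. by rewrite rba_coefD rba_coefN. Qed.

Lemma rba_coef_bounded f : exists d, forall n, (d <= n)%N -> f@_n = 0.
Proof.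
exists (\max_(m <- msupp f) m).+1 => n lt_n; apply: mcoeff_outdom.
by apply: contraL lt_n => nf; rewrite -leqNgt (leq_bigmax_seq _ nf).
Qed.

Lemma rba_top f :
  f <> 0 -> exists2 n, f@_n != 0 & forall i, (n < i)%N -> f@_i = 0.
Proof.
move=> f0; have [d df] := rba_coef_bounded f.
have ex : exists n, f@_n != 0.
  apply: contrapT => nex; apply: f0; apply/rbaP => n; rewrite rba_coef0.
  by apply/eqP; apply/negPn/negP => fn; apply: nex; exists n.
have bd n : f@_n != 0 -> (n <= d)%N.
  by apply: contraR; rewrite -ltnNge => /ltnW/df ->.
case: (ex_maxnP ex bd) => n fn nmax; exists n => // i lt_ni.
by apply/eqP; apply: contraTT lt_ni => /nmax; rewrite -leqNgt.
Qed.

(** [b = 0] is allowed, so elements of degree below [i] count too; this absorbs the separate [{0}]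
    of [Omega] and needs no case split on vanishing sums. *)
Definition leading_coefs W (i : nat) : set k :=
  [set b | exists2 f, W f & f@_i = b /\ forall j, (i < j)%N -> f@_j = 0].

Lemma Omega_leading_coefs I i : I 0 -> Omega I i = leading_coefs I i.
Proof.
move=> I0; apply/seteqP; split=> [b [->|[f [If f0] fin]]|b [f If [<- fi]]].
- by exists 0 => //; split=> [|j _]; rewrite rba_coef0.
- exists f => //; have [n fn fgt] := rba_top f0.
  rewrite (rba_inE fn fgt) in fin.
  (* In degree [n], the top degree of [f]: either [i = n] and [b] is the top coefficient, or that
     coefficient would vanish. *)
  have /(congr1 (fun g : A => g@_n)) := fin.
  rewrite !rba_coefZ !rba_coef_basis eqxx mulr1.
  by case: eqP => [->|_]; rewrite ?mulr1 ?mulr0 // => f_n0; rewrite f_n0 eqxx in fn.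
- have [->|fi0] := eqVneq f@_i 0; first by left.
  right; exists f; last exact: rba_inE.
  by split=> // f0; rewrite f0 rba_coef0 eqxx in fi0.
Qed.

(** Existence: an element of [W] corrects the top coefficient to its representative, and the rest
    has smaller degree. Uniqueness: the top coefficient of a difference of two representatives of
    one coset is a leading coefficient of [W]. *)
Lemma complete_reprs_coefwise W (S : nat -> set k) :
    is_subgroup W ->
    (forall i, complete_reprs (leading_coefs W i) (S i) /\ S i 0) ->
  complete_reprs W [set f | forall i, S i f@_i].
Proof.
move=> sW repS; have [W0 WB] := sW; move=> f.
(* The degree bound on [t] serves the induction: it keeps degree [d] free for the term [c *: 'a_d]
   added at the next stage. *)
have ex d : forall g, (forall i, (d <= i)%N -> g@_i = 0) -> exists t : A,
    [/\ forall i, S i t@_i, W (t - g) & forall i, (d <= i)%N -> t@_i = 0].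
  elim: d => [|d IHd] g gd.
    exists 0; split=> [i||i _]; rewrite ?rba_coef0 //; first by case: (repS i).
    suff -> : g = 0 by rewrite subrr.
    by apply/rbaP => i; rewrite gd ?rba_coef0.
  (* [c] represents [g@_d], and [h] in [W] has top coefficient [c - g@_d]; hence [g + h - c *: 'a_d]
     vanishes from degree [d] on. *)
  have [/(_ g@_d) [c [[Sc [h Wh [hd hgt]]] _]] _] := repS d.
  have [|t [St Wt td]] := IHd (g + h - c *: 'a_d).
    move=> i; rewrite leq_eqVlt rba_coefB rba_coefD rba_coefZ rba_coef_basis.
    case/predU1P=> [<-|lt_di]; first by rewrite eqxx mulr1 hd [g@_d + _]addrC subrK subrr.
    by rewrite gd // hgt // ltn_eqF // mulr0 subr0 addr0.
  exists (t + c *: 'a_d); split=> [i||i lt_di].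
  - rewrite rba_coefD rba_coefZ rba_coef_basis.
    case: eqP => [<-|_]; last by rewrite mulr0 addr0.
    by rewrite td // add0r mulr1.
  - suff -> : t + c *: 'a_d - g = (t - (g + h - c *: 'a_d)) + h by apply: is_subgroupD.
    by rewrite opprB opprD !addrA subrK.
  - by rewrite rba_coefD td ?(ltnW lt_di) //
      rba_coefZ rba_coef_basis ltn_eqF // mulr0 addr0.
have [d df] := rba_coef_bounded f.
have [t [St Wt _]] := ex d f df; exists t; split=> // t' [St' Wt'].
apply: contrapT => /eqP; rewrite -subr_eq0 => /eqP/rba_top[n tn tgt].
have Ln : leading_coefs W n (t@_n - t'@_n).
  exists (t - t'); last by rewrite rba_coefB.
  by rewrite -[t - t'](subrKA f) -[f - t']opprB; apply: WB.
(* [t@_n] and [t'@_n] both represent the coset of [t'@_n], so they agree, although [n] is the top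
   degree where [t] and [t'] differ. *)
have [/(_ t'@_n)[u [_ uU]] _] := repS n.
move: tn; rewrite rba_coefB -(uU t@_n) // -(uU t'@_n) ?subrr ?eqxx //.
split=> //; exists 0 => //.
by split=> [|j _]; rewrite rba_coef0.
Qed.

End LeadingCoefficients.

(** * The ideals [Omega I i] and the coefficientwise form of the initial ideal *)

Section RotaBaxterIdeal.
Context {k : comPzRingType} {lam : k} (I : set (rba lam)).
Hypothesis rbI : rb_ideal I.
Notation A := (rba lam).

Lemma ideal_scale (J : set A) c f : is_ideal J -> J f -> J (c *: f).
Proof. by move=> [_ _ JM] Jf; rewrite -[f]mul1r rba_scalerAl; apply: JM. Qed.

Lemma rb_ideal0 : I 0.
Proof. by have [[]] := rbI. Qed.

Lemma rba_coef_P0 (f : A) : (rba_P f)@_0%N = 0.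
Proof.
elim/(@rba_ind k lam): f => [|f g f0 g0|c f f0|m].
- by rewrite rba_P0 rba_coef0.
- by rewrite rba_PD rba_coefD f0 g0 addr0.
- by rewrite rba_PZ rba_coefZ f0 mulr0.
- by rewrite rba_P_basis rba_coef_basis.
Qed.

Lemma rba_coef_PS (f : A) n : (rba_P f)@_n.+1 = f@_n.
Proof.
elim/(@rba_ind k lam): f => [|f g IHf IHg|c f IHf|m].
- by rewrite rba_P0 !rba_coef0.
- by rewrite rba_PD !rba_coefD IHf IHg.
- by rewrite rba_PZ !rba_coefZ IHf.
- by rewrite rba_P_basis !rba_coef_basis eqSS.
Qed.

Lemma Omega_is_ideal i : is_ideal (Omega I i).
Proof.
have idI := rbI.1; have [_ ID _] := idI.
rewrite (Omega_leading_coefs _ rb_ideal0); split.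
- by exists 0; [exact: rb_ideal0|split=> [|j _]; rewrite rba_coef0].
- move=> _ _ [f If [<- fi]] [g Ig [<- gi]]; exists (f + g); first exact: ID.
  by split=> [|j ltj]; rewrite rba_coefD // fi // gi // addr0.
- move=> a _ [f If [<- fi]]; exists (a *: f); first exact: ideal_scale.
  by split=> [|j ltj]; rewrite rba_coefZ // fi // mulr0.
Qed.

(** [rba_P] raises the degree by one and keeps the leading coefficient. *)
Lemma Omega_leq i j : (i <= j)%N -> Omega I i `<=` Omega I j.
Proof.
elim: j => [|j IHj]; first by rewrite leqn0 => /eqP ->.
rewrite leq_eqVlt => /predU1P[-> //|/IHj ij]; apply: subset_trans ij _.
rewrite !(Omega_leading_coefs _ rb_ideal0) => _ [f If [<- fj]].
exists (rba_P f); first by apply: rbI.2; exists f.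
by split=> [|[//|l] ltl]; rewrite rba_coef_PS // fj.
Qed.

Lemma coefwise_rb_ideal : rb_ideal [set f : A | forall i, Omega I i f@_i].
Proof.
have JD : forall f g : A, (forall i, Omega I i f@_i) ->
    (forall i, Omega I i g@_i) -> forall i, Omega I i (f + g)@_i.
  by move=> f g Jf Jg i; have [_ D _] := Omega_is_ideal i; rewrite rba_coefD; apply: D.
have J0 : forall i, Omega I i (0 : A)@_i.
  by move=> i; rewrite rba_coef0; case: (Omega_is_ideal i).
have JZ : forall c (f : A), (forall i, Omega I i f@_i) ->
    forall i, Omega I i (c *: f)@_i.
  by move=> c f Jf i; have [_ _ M] := Omega_is_ideal i; rewrite rba_coefZ; apply: M.
split; first split=> //.
  (* Linearity in both factors reduces the claim to [f@_n *: ('a_m * 'a_n)]. *)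
  move=> a f Jf; rewrite /= [f]rba_sumE mulr_sumr.
  elim/big_rec: _ => // n g _ Jg; apply: (JD _ _ _ Jg) => {g Jg}.
  rewrite -rba_scalerAr; elim/(@rba_ind k lam): a => [|g h Jg Jh|c g Jg|m].
  - by rewrite mul0r scaler0.
  - by rewrite mulrDl scalerDr; apply: JD.
  - by rewrite -rba_scalerAl scalerA mulrC -scalerA; apply: JZ.
  rewrite rba_basisM scaler_sumr; elim/big_rec: _ => // i g _ Jg.
  apply: (JD _ _ _ Jg) => {g Jg} j.
  rewrite scalerA rba_coefZ rba_coef_basis; case: eqP => [e|_]; last first.
    by rewrite mulr0; case: (Omega_is_ideal j).
  (* Here [j = m + n - i] with [i <= m]. *)
  have le_nj : (n <= j)%N.
    have := ltn_ord i; rewrite ltnS leq_min => /andP[le_im _].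
    by rewrite -e -addnBAC // leq_addl.
  have [_ _ M] := Omega_is_ideal j.
  by rewrite mulr1 mulrC; apply: M; apply: (Omega_leq le_nj).
move=> _ [f Jf <-] [|i] /=.
  by rewrite rba_coef_P0; case: (Omega_is_ideal 0%N).
by rewrite rba_coef_PS; apply: (Omega_leq (leqnSn i)).
Qed.

(** One inclusion is minimality of the generated ideal. For the other, each term [f@_n *: 'a_n] is
    zero or the initial term of an element of [I]. *)
Lemma initial_idealE :
  initial_ideal I = [set f : A | forall i, Omega I i f@_i].
Proof.
apply/seteqP; split.
  move=> f; apply; split; first exact: coefwise_rb_ideal.
  move=> _ [g [Ig g0] <-] i; have [n gn ggt] := rba_top g0.
  have ing := rba_inE gn ggt.
  rewrite ing rba_coefZ rba_coef_basis; case: eqP => [<-|_]; last first.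
    by rewrite mulr0; case: (Omega_is_ideal i).
  by rewrite mulr1; right; exists g.
have idJ := (initial_ideal_rb_ideal I).1; have [J0 JD _] := idJ.
move=> f Jf; rewrite [f]rba_sumE; elim/big_rec: _ => // n g _ Jg.
apply: JD Jg; case: (Jf n) => [-> |[h Ih <-]]; first by rewrite scale0r.
by move=> J [_]; apply; exists h.
Qed.

(** This is what lets one set of representatives serve both quotients. A monomial [b *: 'a_i] with
    [b] in [Omega I i] lies in the initial ideal. *)
Lemma initial_ideal_leading_coefs i :
  leading_coefs (initial_ideal I) i = leading_coefs I i.
Proof.
rewrite -(Omega_leading_coefs _ rb_ideal0) initial_idealE.
apply/seteqP; split=> [_ [f Jf [<- _]]|b Ob]; first exact: Jf.
exists (b *: 'a_i) => [j|].
  rewrite rba_coefZ rba_coef_basis; case: eqP => [<-|_]; first by rewrite mulr1.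
  by rewrite mulr0; case: (Omega_is_ideal j).
split=> [|j ltj]; rewrite rba_coefZ rba_coef_basis ?eqxx ?mulr1 //.
by rewrite ltn_eqF // mulr0.
Qed.

End RotaBaxterIdeal.

(** * The blocks cut out of the degrees by an increasing enumeration *)

Section Blocks.
Variables (D : set nat) (N : option nat) (s : nat -> nat).
Hypothesis enumD : increasing_enum D N s.

Lemma le_index_leq i j : (i <= j)%N -> le_index N j -> le_index N i.
Proof. by case: N => //= n; apply: leq_trans. Qed.

Lemma enum_leq i j : (i <= j)%N -> le_index N j -> (s i <= s j)%N.
Proof.
case: i => [|i]; first by rewrite (Defs.enum0 enumD).
rewrite leq_eqVlt => /predU1P[-> //|lt_ij] Nj; apply: ltnW.
apply: (enum_lt enumD) => //; rewrite /pos_index /=.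
  exact: le_index_leq (ltnW lt_ij) Nj.
by rewrite Nj (leq_trans _ lt_ij).
Qed.

(** The predecessor is due to the possible equality [s 0 = s 1 = 0]. The bound leaves only finitely
    many [j] with [s j <= i]. *)
Lemma enum_ge_pred j : le_index N j -> (j.-1 <= s j)%N.
Proof.
elim: j => [|[|j] IHj] // Nj.
have Nj1 := le_index_leq (leqnSn _) Nj.
by apply: leq_ltn_trans (IHj Nj1) _; apply: (enum_lt enumD).
Qed.

Lemma in_block_exists i : exists2 j, le_index N j & in_block N s j i.
Proof.
(* The block containing [i] is given by the largest [j] satisfying [Q]. *)
pose Q j := le_index N j && (s j <= i)%N.
have exQ : exists j, Q j.
  by exists 0%N; rewrite /Q (Defs.enum0 enumD) leq0n andbT; case: (N).
have bdQ j : Q j -> (j <= i.+1)%N.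
  by case/andP=> /enum_ge_pred le1 /(leq_trans le1); case: (j).
case: (ex_maxnP exQ bdQ) => j /andP[Nj sj] jmax; exists j => //; split=> // NSj.
rewrite ltnNge; apply/negP => le_si; have := jmax j.+1.
by rewrite /Q NSj le_si ltnn => /(_ isT).
Qed.

Lemma in_block_ltn_false i j l :
  (j < l)%N -> le_index N l -> in_block N s j i -> in_block N s l i -> False.
Proof.
move=> lt_jl Nl [_ /(_ (le_index_leq lt_jl Nl)) lt_i] [le_i _].
by have := leq_trans lt_i (leq_trans (enum_leq lt_jl Nl) le_i); rewrite ltnn.
Qed.

Lemma in_block_inj i j l : le_index N j -> le_index N l ->
  in_block N s j i -> in_block N s l i -> j = l.
Proof.
move=> Nj Nl bj bl; case: (ltngtP j l) => // lt.
  by case: (in_block_ltn_false lt Nl bj bl).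
by case: (in_block_ltn_false lt Nj bl bj).
Qed.

(** Thus no element of [D] lies strictly between [s j] and [i] or equals [i > s j]; for [j = 0]
    there is none up to [i] at all. *)
Lemma in_block_no_enum i j t : le_index N j -> in_block N s j i -> D t ->
  (t <= i)%N -> exists2 l, (0 < l <= j)%N & t = s l.
Proof.
move=> Nj [_ lt_i]; rewrite -(enum_range enumD) => -[l /andP[l0 Nl] <-] le_i.
exists l => //; rewrite l0 leqNgt; apply/negP => lt_jl.
have := leq_trans (lt_i (le_index_leq lt_jl Nl)) (leq_trans (enum_leq lt_jl Nl) le_i).
by rewrite ltnn.
Qed.

End Blocks.

(** * Constancy of [Omega] on each block *)

Section OmegaOnBlocks.
Context {k : comPzRingType} {lam : k} (I : set (rba lam)).
Hypothesis rbI : rb_ideal I.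

Lemma Omega_pred_subset t : Omega_pred I t `<=` Omega I t.
Proof.
case: t => [|t] /=; last exact: Omega_leq.
by move=> _ ->; case: (Omega_is_ideal rbI 0).
Qed.

Lemma Omega_pred_eq t : ~ ascent I t -> Omega I t = Omega_pred I t.
Proof.
move=> nasc; apply/seteqP; split; last exact: Omega_pred_subset.
by apply: contrapT => nsub; apply: nasc; split=> //; exact: Omega_pred_subset.
Qed.

Lemma Omega_constant m n : (m <= n)%N ->
  (forall t, (m < t <= n)%N -> ~ ascent I t) -> Omega I n = Omega I m.
Proof.
elim: n => [|n IHn]; first by rewrite leqn0 => /eqP ->.
rewrite leq_eqVlt => /predU1P[-> //|lt_mn] nasc.
rewrite Omega_pred_eq /=; last by apply: nasc; rewrite lt_mn /=.
by apply: IHn => // t /andP[lt_mt le_tn]; apply: nasc; rewrite lt_mt leqW.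
Qed.

Lemma Omega_at_block N s i j : ascent_enum I N s ->
  le_index N j -> in_block N s j i -> Omega_at I s j = Omega I i.
Proof.
move=> enumI Nj bji; have noasc := in_block_no_enum enumI Nj bji.
case: j => [|j] in Nj bji noasc *.
  (* In block [0] even [t = 0] is no ascent, so [Omega I 0] is the zero ideal, matching the
     convention for [Omega_at] at [0]. *)
  have n0 t : (t <= i)%N -> ~ ascent I t.
    by move=> le_t /noasc/(_ le_t)[l]; case: l.
  rewrite (Omega_constant (leq0n i)) => [|t /andP[_ /n0] //].
  by rewrite Omega_pred_eq //; apply: n0.
rewrite (Omega_constant bji.1) // => t /andP[lt_st le_ti] /noasc/(_ le_ti)[l].
by case/andP=> _ le_l et; move: lt_st; rewrite et ltnNge (enum_leq enumI).
Qed.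

End OmegaOnBlocks.

Theorem theorem3p9 (k : comPzRingType) (lam : k) (I : set (rba lam))
    (N : option nat) (s : nat -> nat) :
  rb_ideal I -> ascent_enum I N s ->
  (exists T : nat -> set k, reprs_family I N s T) /\
  (forall T : nat -> set k, reprs_family I N s T ->
     complete_reprs I (reprs_sum N s T) /\
     complete_reprs (initial_ideal I) (reprs_sum N s T)).
Proof.
move=> rbI enumI; split.
  (* This holds also for [j] beyond [N], where [s j] is arbitrary, since every [Omega I i] is an
     ideal; so choice applies to all [j] at once. *)
  have ex j : exists Tj, complete_reprs (Omega_at I s j) Tj /\ Tj 0.
    apply: complete_reprs_exists; case: j => [|j] /=.
      by split=> // x y -> ->; rewrite subrr.
    exact/is_ideal_subgroup/Omega_is_ideal.
  by have [T TP] := choice ex; exists T => j _; apply: TP.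
move=> T repT.
(* [b i] is the index of the block of [i]; it turns the blockwise condition into one on each
   coefficient. *)
have [b bP] : exists b, forall i, le_index N (b i) /\ in_block N s (b i) i.
  have ex i : exists j, le_index N j /\ in_block N s j i.
    by have [j] := in_block_exists enumI i; exists j.
  by have [b bP] := choice ex; exists b.
have -> : reprs_sum N s T = [set f : rba lam | forall i, T (b i) f@_i].
  apply/seteqP; split=> [f Tf i|f Tf j i Nj bj].
    by have [] := bP i; apply: Tf.
  by have [Nb bb] := bP i; rewrite (in_block_inj enumI Nj Nb bj bb).
have repL i : complete_reprs (leading_coefs I i) (T (b i)) /\ T (b i) 0.
  have [Nb bb] := bP i; rewrite -(Omega_leading_coefs i (rb_ideal0 rbI)).
  by rewrite -(Omega_at_block rbI enumI Nb bb); apply: repT.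
split; apply: (@complete_reprs_coefwise k lam _ (fun i => T (b i))) => //.
- by apply: is_ideal_subgroup; case: rbI.
- by apply: is_ideal_subgroup; case: (initial_ideal_rb_ideal I).
- by move=> i; rewrite initial_ideal_leading_coefs.
Qed.
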